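(* Let $F$ be a field of characteristic $\neq 2$, let $V$ be a vector space of dimension $n$ over $F$, let $Q$ be a nondegenerate symmetric bilinear form on $V$, let $\{e_1,\dots,e_n\}$ be a $Q$-orthogonal basis of $V$, and let $\omega = e_1\cdots e_n\in C\ell(V,Q)$. Let $\mathfrak{G} = \{\xi \in C\ell(V,Q) : c(\xi) = -\xi\}$ and let $\mathfrak{Z}(\mathfrak{G})$ be its center. If $n$ is even or $n \equiv 3 \pmod 4$, then $\mathfrak{Z}(\mathfrak{G}) = \{0\}$. If $n \equiv 1 \pmod 4$, then $\mathfrak{Z}(\mathfrak{G}) = F\text{-span}\{\omega\}$.
   Context: $C\ell(V,Q)$ is the Clifford algebra: the universal associative unital $F$-algebra containing $V$ in which $v\cdot v = -Q(v,v)1$ for all $v\in V$. The map $c$ is the unique algebra anti-automorphism of $C\ell(V,Q)$ with $c(v)=-v$ for all $v\in V$. $\mathfrak{G}$ is a Lie algebra under $[x,y]=xy-yx$, and $\mathfrak{Z}(\mathfrak{G}) = \{\xi\in\mathfrak{G} : \mathrm{ad}\,\xi=0 \text{ on } \mathfrak{G}\}$. *)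

(* Defs.v *)
From HB Require Import structures.
From mathcomp Require Import all_boot all_order all_algebra.

Set Implicit Arguments.
Unset Strict Implicit.
Unset Printing Implicit Defensive.

Import GRing.Theory.
Local Open Scope ring_scope.

(* [A], with [iota] as the inclusion of [V], is the Clifford algebra Cl(V, Q),
   with the sign convention v * v = - Q(v, v) 1. The universal property pins
   (A, iota) down up to a unique isomorphism. Uniqueness of the induced
   morphism is pointwise because equality of bundled morphisms is finer than
   equality of functions. *)
Definition is_clifford_algebra (F : fieldType) (V : lmodType F)
    (Q : {symmetric V}) (A : algType F) (iota : {linear V -> A}) : Prop :=
  [/\ injective iota,
      forall v : V, iota v * iota v = - (Q v v)%:A
    & forall (B : algType F) (f : {linear V -> B}),
        (forall v : V, f v * f v = - (Q v v)%:A) ->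
        exists2 g : {lrmorphism A -> B},
          forall v : V, g (iota v) = f v
        & forall h : {lrmorphism A -> B},
            (forall v : V, h (iota v) = f v) -> h =1 g].

Definition anti_automorphism (F : fieldType) (A : algType F)
    (c : {linear A -> A}) : Prop :=
  [/\ bijective c, c 1 = 1 & {morph c : x y / x * y >-> y * x}].

Definition lie_bracket (A : pzRingType) (x y : A) : A := x * y - y * x.

Definition skew_elements (A : nzRingType) (c : A -> A) : pred A :=
  [pred xi | c xi == - xi].

Definition lie_center (A : nzRingType) (G : pred A) (xi : A) : Prop :=
  xi \in G /\ {in G, forall eta, lie_bracket xi eta = 0}.

(* Main.v *)
Require Import Defs.
From HB Require Import structures.
From mathcomp Require Import all_boot all_order all_algebra.
From mathcomp Require Import boolp zify.
Import GRing.Theory.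
Local Open Scope ring_scope.

(* Write e_S for the ordered product of the e_i with i in S. The e_S span the
   Clifford algebra, because the universal property forces every subalgebra
   containing V to be everything, and the span of the e_S is stable under left
   multiplication by the e_i. Each e_i commutes or anticommutes with e_S
   according to the parity of |S \ {i}|. A central element of G commutes with
   all e_i, which lie in G; as 2 is invertible, only the e_S commuting with
   every e_i survive in its expansion, namely e_{} = 1 and, for n odd,
   e_{1..n} = omega. Finally c(1) = 1 and c(omega) = (-1)^(n(n+1)/2) omega.
   Linear independence of the e_S is never needed. *)

(** * Generation of the Clifford algebra by [V] *)

Record subalg_of {F : fieldType} {A : algType F} (S : subalgClosed A) :=
  SubalgOf { subalg_val : A; _ : subalg_val \in S }.

HB.instance Definition _ {F : fieldType} {A : algType F} (S : subalgClosed A) :=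
  [isSub for @subalg_val F A S].
HB.instance Definition _ {F : fieldType} {A : algType F} (S : subalgClosed A) :=
  [Choice of subalg_of S by <:].
HB.instance Definition _ {F : fieldType} {A : algType F} (S : subalgClosed A) :=
  [SubChoice_isSubAlgebra of subalg_of S by <:].

(** The universal property takes bundled algebras as targets, so [S] becomes the type [subalg_of S].
    Corestricting [iota] induces a morphism from [A] to it; followed by the inclusion, this fixes
    [V], hence is the identity by uniqueness. *)
Lemma clifford_subalg {F : fieldType} {V : vectType F} {Q : {symmetric V}}
    {A : algType F} {iota : {linear V -> A}} (S : subalgClosed A) :
  is_clifford_algebra Q iota -> (forall v, iota v \in S) ->
  forall x, x \in S.
Proof.
move=> [_ sq univ] iotaS x.
pose B := subalg_of S.
pose f v : B := SubalgOf _ _ S (iota v) (iotaS v).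
have f_lin : linear f by move=> a u v; apply: val_inj; rewrite /= !linearP.
pose fL : {linear V -> B} := HB.pack f (GRing.isLinear.Build F V B _ f f_lin).
have f_sq v : fL v * fL v = - (Q v v)%:A.
  by apply: val_inj; rewrite /= sq.
have [g gE _] := univ B fL f_sq.
have [h _ uniqA] := univ A iota sq.
pose vgf x : A := val (g x).
have vg_lin : linear vgf by move=> a u v; rewrite /vgf !linearP.
have vg_mul : monoid_morphism vgf.
  by split=> [|u v]; rewrite /vgf ?rmorph1 ?rmorphM.
pose vg : {lrmorphism A -> A} :=
  HB.pack vgf (GRing.isLinear.Build F A A _ vgf vg_lin)
    (GRing.isMonoidMorphism.Build A A vgf vg_mul).
have vgE : vg =1 h by apply: uniqA => v; rewrite /= /vgf gE.
have idE : (idfun : {lrmorphism A -> A}) =1 h by exact: uniqA.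
by have -> : x = vg x; [rewrite vgE -idE | exact: valP].
Qed.

Lemma clifford_ind {F : fieldType} {V : vectType F} {Q : {symmetric V}}
    {A : algType F} {iota : {linear V -> A}} (P : A -> Prop) :
  is_clifford_algebra Q iota -> P 1 -> (forall v, P (iota v)) ->
  (forall a x y, P x -> P y -> P (a *: x + y)) ->
  (forall x y, P x -> P y -> P (x * y)) ->
  forall x, P x.
Proof.
move=> clif P1 Pi PD PM x; pose S : {pred A} := fun x => `[< P x >].
have S_closed : subalg_closed S.
  split=> [|a u v /asboolP Pu /asboolP Pv|u v /asboolP Pu /asboolP Pv];
    apply/asboolP; [exact: P1|exact: PD|exact: PM].
pose SA : subalgClosed A :=
  HB.pack S (GRing.isSubalgClosed.Build F A S S_closed).
apply/asboolP; apply: (clifford_subalg SA clif) => v.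
exact/asboolP/Pi.
Qed.

(** * Products of anticommuting generators *)

Lemma eq_opp_0 {F : fieldType} {V : lmodType F} (two_neq0 : 2%:R != 0 :> F)
    (x : V) : x = - x -> x = 0.
Proof.
move=> /eqP; rewrite -addr_eq0 -mulr2n -scaler_nat scaler_eq0.
by rewrite (negPf two_neq0) => /eqP.
Qed.

(** Passing a factor of index other than [i] costs one sign; passing [E i] itself costs none. *)
Lemma mul_gen_prod {A : nzRingType} {I : eqType} (E : I -> A)
    (anti : forall i j, i != j -> E i * E j = - (E j * E i))
    (i : I) (p : pred I) (r : seq I) :
  E i * \prod_(j <- r | p j) E j =
  (-1) ^+ count [predI p & predC1 i] r * (\prod_(j <- r | p j) E j * E i).
Proof.
elim: r => [|j r IH]; first by rewrite !big_nil mul1r mulr1 mul1r.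
rewrite !big_cons /= !inE unfold_in; case: (p j) => //=.
have [->|ji] := eqVneq j i; first by rewrite add0n {1}IH !mulrA commr_sign.
rewrite mulrA anti 1?eq_sym // mulNr -!mulrA IH add1n exprS mulN1r mulNr.
by rewrite !mulrA commr_sign.
Qed.

(** [E i] is moved to its own slot in [r]; there it is either inserted or contracted with the [E i]
    already present into [q i]. So [b] is 1 or [q i] up to sign. *)
Lemma gen_mul_prod_toggle {F : fieldType} {A : algType F} {I : eqType}
    {E : I -> A} {q : I -> F} (sq : forall i, E i * E i = (q i)%:A)
    (anti : forall i j, i != j -> E i * E j = - (E j * E i))
    (i : I) (p : pred I) (r : seq I) : uniq r -> i \in r ->
  exists b : F, E i * \prod_(j <- r | p j) E j =
    b *: \prod_(j <- r | p j (+) (j == i)) E j.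
Proof.
elim: r => //= j r IH /andP[jr ur]; rewrite inE !big_cons.
have [eij _|ij /=] := eqVneq i j.
  subst j.
  have -> : \prod_(k <- r | p k (+) (k == i)) E k = \prod_(k <- r | p k) E k.
    rewrite big_seq_cond [RHS]big_seq_cond; apply: eq_bigl => k.
    by have [->|] := eqVneq k i; [rewrite (negPf jr)|rewrite addbF].
  rewrite addbT; case: (p i) => /=.
    by exists (q i); rewrite mulrA sq -scalerAl mul1r.
  by exists 1; rewrite scale1r.
move=> ir; have [b Eb] := IH ur ir; rewrite addbF.
case: (p j); last by exists b.
by exists (- b); rewrite mulrA anti // mulNr -mulrA Eb -scalerAr scaleNr.
Qed.

(** For m factors, the generators contribute m signs and undoing the reversal m(m-1)/2, in all
    m(m+1)/2. *)
Lemma anti_auto_prod {F : fieldType} {A : algType F} {I : eqType}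
    {E : I -> A}
    (anti : forall i j, i != j -> E i * E j = - (E j * E i))
    {c : {linear A -> A}} (c_anti : anti_automorphism c)
    (cE : forall i, c (E i) = - E i) (r : seq I) : uniq r ->
  c (\prod_(i <- r) E i) = (-1) ^+ 'C((size r).+1, 2) * \prod_(i <- r) E i.
Proof.
have [_ c1 cM] := c_anti.
elim: r => [|i r IH] /=; first by rewrite !big_nil c1 mul1r.
move=> /andP[ir ur]; rewrite !big_cons cM cE IH //.
(* Pascal's rule adds [size r + 1] to the inductive exponent: one sign from [c (E i)] and [size r]
   from moving [E i] past the rest. *)
rewrite [in RHS](mul_gen_prod _ anti) (binS _.+1) bin1 exprD.
have -> : count [predI xpredT & predC1 i] r = size r.
  rewrite -(count_predT r); apply: eq_in_count => j jr /=.
  by apply: contraNneq ir => <-.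
by rewrite exprS mulN1r -!mulrA mulNr signrMK !mulrN.
Qed.

Lemma clifford_basis_ind {F : fieldType} {V : vectType F} {Q : {symmetric V}}
    {A : algType F} {iota : {linear V -> A}} {n : nat} {e : n.-tuple V}
    (P : A -> Prop) :
  is_clifford_algebra Q iota -> basis_of {:V} e ->
  P 1 -> (forall i, P (iota (tnth e i))) ->
  (forall a x y, P x -> P y -> P (a *: x + y)) ->
  (forall x y, P x -> P y -> P (x * y)) ->
  forall x, P x.
Proof.
move=> clif e_basis P1 Pe PD PM; apply: (clifford_ind P clif) => // v.
rewrite (coord_basis e_basis (memvf v)) linear_sum.
(* The empty sum of coordinates needs [P 0]; here 0 arises as (-1) 1 + 1. *)
have P0 : P 0 by have := PD (-1) _ _ P1 P1; rewrite scaleN1r addNr.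
elim/big_rec: _ => // i x _ Px; rewrite linearZ /= -(tnth_nth 0).
exact: PD (Pe i) Px.
Qed.

(** * Monomials and their span *)

Definition gen_monomial {A : nzRingType} {n : nat} (E : 'I_n -> A)
  (S : {set 'I_n}) : A := \prod_(i < n | i \in S) E i.

Definition monomial_span {F : fieldType} {A : algType F} {n : nat}
    (E : 'I_n -> A) (x : A) : Prop :=
  exists a : {set 'I_n} -> F, x = \sum_S a S *: gen_monomial E S.

Lemma monomial_span_lin {F : fieldType} {A : algType F} {n : nat}
    (E : 'I_n -> A) (a : F) (x y : A) :
  monomial_span E x -> monomial_span E y -> monomial_span E (a *: x + y).
Proof.
move=> [b ->] [d ->]; exists (fun S => a * b S + d S).
rewrite scaler_sumr -big_split /=; apply: eq_bigr => S _.
by rewrite scalerDl scalerA.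
Qed.

Lemma monomial_span0 {F : fieldType} {A : algType F} {n : nat}
    (E : 'I_n -> A) : monomial_span E 0.
Proof. by exists (fun=> 0); rewrite big1 // => S _; rewrite scale0r. Qed.

Lemma monomial_span_monomial {F : fieldType} {A : algType F} {n : nat}
    (E : 'I_n -> A) (S : {set 'I_n}) : monomial_span E (gen_monomial E S).
Proof.
exists (fun T => (T == S)%:R); rewrite (bigD1 S) //= eqxx scale1r big1 ?addr0 //.
by move=> T /negPf->; rewrite scale0r.
Qed.

Lemma gen_mul_monomial {F : fieldType} {A : algType F} {n : nat} {E : 'I_n -> A}
    {q : 'I_n -> F} (sq : forall i, E i * E i = (q i)%:A)
    (anti : forall i j, i != j -> E i * E j = - (E j * E i))
    (i : 'I_n) (S : {set 'I_n}) : monomial_span E (E i * gen_monomial E S).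
Proof.
have [b Eb] := gen_mul_prod_toggle sq anti i (fun j => j \in S) _
  (index_enum_uniq _) (mem_index_enum i).
pose T := [set j | (j \in S) (+) (j == i)].
have -> : E i * gen_monomial E S = b *: gen_monomial E T + 0.
  rewrite addr0 /gen_monomial Eb; congr (_ *: _).
  by apply: eq_bigl => j; rewrite inE.
exact: monomial_span_lin (monomial_span_monomial E T) (monomial_span0 E).
Qed.

Lemma clifford_monomial_span {F : fieldType} {V : vectType F} {Q : {symmetric V}}
    {A : algType F} {iota : {linear V -> A}} {n : nat} {e : n.-tuple V}
    {q : 'I_n -> F}
    (sq : forall i, iota (tnth e i) * iota (tnth e i) = (q i)%:A)
    (anti : forall i j, i != j ->
       iota (tnth e i) * iota (tnth e j) = - (iota (tnth e j) * iota (tnth e i)))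
    (x : A) :
  is_clifford_algebra Q iota -> basis_of {:V} e ->
  monomial_span (iota \o tnth e) x.
Proof.
move=> clif e_basis; set E := iota \o tnth e.
(* Proving stability under left multiplication makes the product case of the
   induction immediate. *)
suff: forall y, monomial_span E y -> monomial_span E (x * y).
  (* The claim is the case y = 1, the monomial of the empty set. *)
  move/(_ (gen_monomial E set0) (monomial_span_monomial _ _)).
  by rewrite /gen_monomial big_set0 mulr1.
move: x; apply: (clifford_basis_ind _ clif e_basis).
- by move=> y; rewrite mul1r.
- move=> i _ [a ->]; rewrite mulr_sumr.
  elim/big_rec: _ => [|S y _ Py]; first exact: monomial_span0.
  rewrite -scalerAr.
  by apply: monomial_span_lin => //; exact: (gen_mul_monomial sq anti).
- move=> a x y Px Py z Pz; rewrite mulrDl -scalerAl.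
  by apply: monomial_span_lin; [exact: Px|exact: Py].
- by move=> x y Px Py z Pz; rewrite -mulrA; exact/Px/Py.
Qed.

(** Let y collect the terms anticommuting with [E i]. Commutation forces y [E i] = - y [E i], so y
    [E i] = 0, and y = 0 because [E i] squares to a nonzero scalar. The sum y is shown to vanish,
    not its coefficients. *)
Lemma commute_filter {F : fieldType} {A : algType F} {n : nat} {E : 'I_n -> A}
    {q : 'I_n -> F} (two_neq0 : 2%:R != 0 :> F)
    (q_neq0 : forall i, q i != 0)
    (sq : forall i, E i * E i = (q i)%:A)
    (anti : forall i j, i != j -> E i * E j = - (E j * E i))
    (i : 'I_n) (a : {set 'I_n} -> F) (P : pred {set 'I_n}) (x : A) :
  x = \sum_(S | P S) a S *: gen_monomial E S -> E i * x = x * E i ->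
  x = \sum_(S | P S && ~~ odd #|S :\ i|) a S *: gen_monomial E S.
Proof.
move=> xE; rewrite {1 2}xE (bigID (fun S => odd #|S :\ i|)) /=.
set y := \sum_(S | P S && odd _) _; set z := \sum_(S | P S && ~~ odd _) _.
have signed S : E i * gen_monomial E S =
    (-1) ^+ odd #|S :\ i| * (gen_monomial E S * E i).
  rewrite /gen_monomial (mul_gen_prod E anti) signr_odd; congr (_ ^+ _ * _).
  rewrite cardE /enum_mem size_filter; apply: eq_count => j.
  by rewrite /= !inE andbC.
have Ez : E i * z = z * E i.
  rewrite mulr_sumr mulr_suml; apply: eq_bigr => S /andP[_ /negPf oS].
  by rewrite -scalerAr signed oS mul1r scalerAl.
have Ey : E i * y = - (y * E i).
  rewrite mulr_sumr mulr_suml -sumrN; apply: eq_bigr => S /andP[_ oS].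
  by rewrite -scalerAr signed oS mulN1r scalerN scalerAl.
rewrite mulrDl mulrDr Ez Ey => /addIr /esym/(eq_opp_0 two_neq0) yE0.
have /eqP : y * E i * E i = 0 by rewrite yE0 mul0r.
rewrite -mulrA sq -scalerAr mulr1 scaler_eq0 (negPf (q_neq0 i)) /= => /eqP y0.
by rewrite xE (bigID (fun S => odd #|S :\ i|)) /= -/y y0 add0r.
Qed.

(** If some i lies in [S], then |S| is odd, and an index j outside [S] would leave |S \ j| = |S|
    odd. *)
Lemma even_setD1 {n : nat} (S : {set 'I_n}) :
  [forall i, ~~ odd #|S :\ i|] = (S == set0) || odd n && (S == setT).
Proof.
apply/forallP/orP => [evenS | [/eqP-> i|/andP[n_odd /eqP->] i]].
- have [->|[i iS]] := set_0Vmem S; [by left|right].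
  have S_odd : odd #|S| by rewrite (cardsD1 i) iS oddS evenS.
  suff ST : S = setT by rewrite ST eqxx andbT -(card_ord n) -cardsT -ST.
  apply/setP => j; rewrite inE; apply: contraTT S_odd => jS.
  by have := evenS j; rewrite (cardsD1 j S) (negPf jS).
- by rewrite set0D cards0.
- have : odd #|[set: 'I_n]| by rewrite cardsT card_ord.
  by rewrite (cardsD1 i) inE.
Qed.

Lemma commute_gens {F : fieldType} {A : algType F} {n : nat} {E : 'I_n -> A}
    {q : 'I_n -> F} (two_neq0 : 2%:R != 0 :> F)
    (q_neq0 : forall i, q i != 0)
    (sq : forall i, E i * E i = (q i)%:A)
    (anti : forall i j, i != j -> E i * E j = - (E j * E i)) (x : A) :
  monomial_span E x -> (forall i, E i * x = x * E i) ->
  exists a b : F, x = a%:A + (if odd n then b *: \prod_(i < n) E i else 0).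
Proof.
move=> [a xE] xC.
(* The generators are imposed one at a time along [r], with the coefficients [a] kept fixed. *)
have {}xE r : x = \sum_(S : {set 'I_n} | all (fun i => ~~ odd #|S :\ i|) r)
    a S *: gen_monomial E S.
  elim: r => // i r IH.
  rewrite [LHS](commute_filter two_neq0 q_neq0 sq anti i _ _ _ IH (xC i)).
  by apply: eq_bigl => S; rewrite andbC.
have {}xE := xE (enum 'I_n).
move: xE.
rewrite (eq_bigl (fun S => (S == set0) || odd n && (S == setT))); last first.
  by move=> S; rewrite -even_setD1; apply/allP/forallP => evenS i //;
    apply: evenS; rewrite mem_enum.
move=> {1}->; exists (a set0), (a setT); have [n_odd|_] := boolP (odd n).
  rewrite (bigD1 set0) ?eqxx //= (bigD1 setT) /=; last first.
    (* As n is odd it is positive, so the full set differs from the empty one. *)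
    by rewrite eqxx orbT -cards_eq0 cardsT card_ord; case: (n) n_odd.
  rewrite big1 ?addr0 /gen_monomial ?big_set0 => [|S]; last first.
    by case/andP=> /andP[/orP[]->].
  by congr (_ + _ *: _); apply: eq_bigl => i; rewrite inE.
rewrite (eq_bigl (pred1 set0)) => [|S]; last by rewrite orbF.
by rewrite big_pred1_eq addr0 /gen_monomial big_set0.
Qed.

(** For n = 2k+1 the binomial is (k+1)(2k+1), which is odd exactly when k is even. *)
Lemma odd_bin2_mod4 (n : nat) : odd n -> odd 'C(n.+1, 2) = (n %% 4 == 1)%N.
Proof.
move=> n_odd; have [k nE] : exists k, n = k.*2.+1.
  by exists n./2; rewrite -{1}(odd_double_half n) n_odd.
rewrite bin2 {n n_odd}nE -doubleS -doubleMl doubleK oddM /= odd_double andbT.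
have -> : k.*2.+1 = (k./2 * 4 + (odd k).*2.+1)%N.
  by rewrite -{1}(odd_double_half k); lia.
by rewrite modnMDl; case: (odd k).
Qed.

(** The recursive predicate covers pairs in list order; symmetry of [Q] supplies the others. *)
Lemma pairwise_orthogonal_tnth {F : fieldType} {V : lmodType F}
    {Q : {symmetric V}} {n : nat} {e : n.-tuple V} :
  pairwise_orthogonal Q e ->
  forall i j, i != j -> Q (tnth e i) (tnth e j) = 0.
Proof.
move=> /andP[_ e_perp].
have {e_perp} /(pairwiseP 0) perp : pairwise (fun u v => Q u v == 0) e.
  elim: (tval e) e_perp => //= u s IH /andP[+ /IH->].
  by rewrite /ortho_rec /= !andbT.
have perp_lt (i j : 'I_n) : (i < j)%N -> Q (tnth e i) (tnth e j) = 0.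
  by move=> ij; rewrite !(tnth_nth 0); apply/eqP/perp; rewrite ?inE ?size_tuple.
move=> i j; rewrite neq_ltn => /orP[/perp_lt //|/perp_lt ji].
by rewrite hermC ji mulr0.
Qed.

Theorem corollary6p3 (F : fieldType) (charF : 2%N \notin [pchar F])
  (V : vectType F) (n : nat) (dimV : \dim {:V} = n)
  (Q : {symmetric V}) (ndQ : nondegenerate Q)
  (Cl : algType F) (iota : {linear V -> Cl})
  (clif : is_clifford_algebra Q iota)
  (c : {linear Cl -> Cl}) (c_anti : anti_automorphism c)
  (c_iota : forall v : V, c (iota v) = - iota v)
  (e : n.-tuple V) (e_basis : basis_of {:V} e)
  (e_orth : pairwise_orthogonal Q e) :
  let omega : Cl := \prod_(i < n) iota (tnth e i) in
  let G : pred Cl := skew_elements c in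
  (~~ odd n \/ n = 3 %[mod 4] ->
     forall xi : Cl, lie_center G xi <-> xi = 0) /\
  (n = 1 %[mod 4] ->
     forall xi : Cl, lie_center G xi <-> exists a : F, xi = a *: omega).
Proof.
have two_neq0 : 2%:R != 0 :> F by move: charF; rewrite inE.
have [_ iota_sq _] := clif; have [_ c1 _] := c_anti.
pose E := iota \o tnth e.
have Q_perp := pairwise_orthogonal_tnth e_orth.
(* An isotropic basis vector would be orthogonal to the whole basis, hence zero by nondegeneracy. *)
have q_neq0 i : - Q (tnth e i) (tnth e i) != 0.
  have /andP[e_neq0 _] := e_orth.
  rewrite oppr_eq0; apply: contraNneq e_neq0 => Qii0.
  suff -> : 0 = tnth e i by rewrite mem_tnth.
  apply/esym/eqP; rewrite -memv0 -(eqP ndQ); apply/mem_orthovP => v _.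
  rewrite (coord_basis e_basis (memvf v)) linear_sumr big1 //= => j _.
  rewrite linearZr /= -(tnth_nth 0).
  by have [<-|ij] := eqVneq i j; rewrite ?Qii0 ?Q_perp ?mulr0.
have sq i : E i * E i = (- Q (tnth e i) (tnth e i))%:A.
  by rewrite /E /= iota_sq scaleNr.
(* Polarization: expand the square of the sum of the two basis vectors. *)
have anti i j : i != j -> E i * E j = - (E j * E i).
  move=> ij; apply/eqP; rewrite -addr_eq0.
  have := iota_sq (tnth e i + tnth e j).
  rewrite linearD /= mulrDl !mulrDr !iota_sq.
  rewrite linearDl !linearDr /= (Q_perp i j ij) (Q_perp j i) 1?eq_sym //.
  rewrite addr0 add0r.
  rewrite scalerDl opprD -!addrA => /addrI.
  by rewrite addrA -[RHS]add0r => /addIr ->.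
move=> omega G.
have GE x : (x \in G) = (c x == - x) by [].
have omegaE : omega = \prod_(i < n) E i by [].
have size_ord : size (index_enum 'I_n) = n.
  by rewrite [index_enum _]unlock -enumT size_enum_ord.
have c_omega : c omega = (-1) ^+ 'C(n.+1, 2) * omega.
  rewrite omegaE (anti_auto_prod anti c_anti) ?index_enum_uniq ?size_ord //.
  by move=> i; exact: c_iota.
have centerP xi : lie_center G xi -> exists a b : F,
    xi = a%:A + (if odd n then b *: omega else 0).
  move=> [_ xi_central]; apply: (commute_gens two_neq0 q_neq0 sq anti).
    exact: (clifford_monomial_span sq anti xi clif e_basis).
  move=> i; apply/esym/eqP; rewrite -subr_eq0; apply/eqP/xi_central.
  by rewrite GE c_iota.
have center0 : lie_center G 0.
  by split=> [|x _]; rewrite ?GE ?linear0 ?oppr0 //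
    /lie_bracket mul0r mulr0 subr0.
split=> [n_mod xi | n_mod xi].
  split=> [xi_center|-> //]; have [xi_skew _] := xi_center.
  have [a [b xiE]] := centerP _ xi_center.
  (* Here [c] also fixes [xi], since it fixes 1 and, for n = 3 mod 4, [omega]; thus [xi] equals its
     opposite. *)
  move: xi_skew; rewrite GE => /eqP xi_skew; apply: (eq_opp_0 two_neq0).
  rewrite -xi_skew xiE linearD linearZ /= c1; congr (_ + _).
  case: ifP n_mod => [n_odd [//|n_mod]|_ _]; last by rewrite linear0.
  by rewrite linearZ /= c_omega -signr_odd odd_bin2_mod4 // n_mod mul1r.
have n_odd : odd n by rewrite -(@odd_mod n 4) // n_mod.
have {}c_omega : c omega = - omega.
  by rewrite c_omega -signr_odd odd_bin2_mod4 // n_mod mulN1r.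
split=> [xi_center | [a ->]].
  have [a [b xiE]] := centerP _ xi_center; exists b.
  (* Since [c] negates [omega] but fixes 1, skewness makes the scalar part its own opposite. *)
  have [/eqP + _] := xi_center; rewrite xiE n_odd linearD !linearZ /= c1 c_omega.
  rewrite scalerN opprD => /addIr /(eq_opp_0 two_neq0) ->; exact: add0r.
split=> [|x _]; first by rewrite GE linearZ /= c_omega scalerN.
(* [E i] passes n - 1 factors of other index, an even number. *)
have omega_gen i : E i * omega = omega * E i.
  rewrite omegaE (mul_gen_prod E anti).
  have := count_predC (pred1 i) (index_enum 'I_n).
  rewrite count_uniq_mem ?index_enum_uniq // mem_index_enum size_ord add1n.
  rewrite (@eq_count _ _ [predI xpredT & predC1 i]) // => /(congr1 odd) /=.
  by rewrite n_odd -signr_odd => /negPf->; rewrite mul1r.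
(* The induction runs over all of [Cl], as [G] is not closed under products. *)
suff omega_central : omega * x = x * omega.
  by rewrite /lie_bracket -scalerAl omega_central scalerAr subrr.
move: x; apply: (clifford_basis_ind _ clif e_basis).
- by rewrite mulr1 mul1r.
- by move=> i; rewrite -[iota _]/(E i) omega_gen.
- by move=> b x y xC yC; rewrite mulrDr mulrDl -scalerAr xC yC scalerAl.
- by move=> x y xC yC; rewrite mulrA xC -mulrA yC mulrA.
Qed.
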